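(* Let $\mathfrak{Q} := (\mathbb{Q}, <, =, >)$ be the concrete domain of the rational numbers with the standard binary order and equality relations, let $\mathsf{child} \in \mathsf{N_R}$ and $\mathsf{salary} \in \mathsf{N_F}$, and let $$C_{\mathsf{ex}} := \mathsf{succ}\big(|\mathsf{child} \cap (\mathsf{salary} < \partial\,\mathsf{salary})| > |\mathsf{child} \cap (\mathsf{salary} < \partial\,\mathsf{salary})^c|\big).$$ Then there is no $\mathcal{ALCOSCC}(\mathfrak{Q})$ concept that contains no feature roles and is equivalent to $C_{\mathsf{ex}}$, i.e. has the same extension as $C_{\mathsf{ex}}$ in every finitely branching interpretation.
   Context: Fix pairwise disjoint, at most countable sets $\mathsf{N_C}, \mathsf{N_R}, \mathsf{N_I}, \mathsf{N_F}$ of concept, role, individual and feature names. A concrete domain is a relational structure $\mathfrak{D} = (D, P_1^D, P_2^D, \dots)$ over a non-empty countable relational signature, each $k$-ary predicate $P$ interpreted as $P^D \subseteq D^k$. A feature path is $f$ or $r f$ ($r \in \mathsf{N_R}$, $f\in\mathsf{N_F}$). A feature pointer is $f$ or $\partial f$; a feature role is $P(\alpha_1,\dots,\alpha_k)$ with feature pointers $\alpha_i$ and $P$ a $k$-ary predicate of $\mathfrak{D}$ (e.g. $(\mathsf{salary} < \partial\,\mathsf{salary})$ is ${<}(\mathsf{salary},\partial\,\mathsf{salary})$). QFBAPA: set terms are built from set variables and $\emptyset, \mathcal{U}$ by $\cap, \cup$ and complement ${}^c$; set constraints are $s \subseteq t$, $s = t$; PA expressions are $n_0 + n_1 |s_1|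 + \dots + n_k |s_k|$ with $n_i \in \mathbb{N}$ and $s_i$ set terms; numerical constraints are $\ell = \ell'$, $\ell < \ell'$ (also written $\ell'>\ell$), $n \mathrel{\mathsf{div}} \ell$. $\mathcal{ALCOSCC}(\mathfrak{D})$ concepts are: concept names $A$, nominals $\{a\}$ ($a\in\mathsf{N_I}$), $\neg C$, $C \sqcap D$, concrete domain restrictions $\exists p_1,\dots,p_k.P$ ($p_i$ feature paths, $P$ a $k$-ary predicate of $\mathfrak{D}$), and successor restrictions $\mathsf{succ}(\mathfrak{con})$ where $\mathfrak{con}$ is a set constraint or numerical constraint whose set variables are role names, concepts and feature roles. An interpretation $\mathcal{I}$ has a non-empty domain $\Delta^\mathcal{I}$, $A^\mathcal{I} \subseteq \Delta^\mathcal{I}$, $r^\mathcal{I} \subseteq \Delta^\mathcal{I}\times\Delta^\mathcal{I}$, $a^\mathcal{I}\in\Delta^\mathcal{I}$ and partial functions $f^\mathcal{I}: \Delta^\mathcal{I} \rightharpoonup D$; it must be finitely branching, i.e. $\mathsf{ars}^\mathcal{I}(d) := \bigcup_{r\in\mathsf{N_R}} r^\mathcal{I}(d)$ is finite for every $d$, where $r^\mathcal{I}(d) = \{e \mid (d,e)\in r^\mathcal{I}\}$. Semantics: $\neg,\sqcap$ as complement/intersection, $\{a\}^\mathcal{I} = \{a^\mathcal{I}\}$; $p^\mathcal{I}(d) = \{f^\mathcal{I}(d)\}$ if $p=f$ (empty if undefined) and $p^\mathcal{I}(d) = \{f^\mathcal{I}(e) \mid e \in r^\mathcal{I}(d)\}$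 (defined values) if $p = rf$; $d \in (\exists p_1,\dots,p_k.P)^\mathcal{I}$ iff some tuple in $p_1^\mathcal{I}(d)\times\dots\times p_k^\mathcal{I}(d)$ is in $P^D$. For $\gamma = P(\alpha_1,\dots,\alpha_k)$, $(d,e)\in\gamma^\mathcal{I}$ iff $(c_1,\dots,c_k)\in P^D$ where $c_i = f_i^\mathcal{I}(d)$ if $\alpha_i = f_i$ and $c_i = f_i^\mathcal{I}(e)$ if $\alpha_i = \partial f_i$ (all defined). Each $d$ induces the QFBAPA assignment $\sigma_d$ with $\sigma_d(\mathcal{U}) = \mathsf{ars}^\mathcal{I}(d)$, $\sigma_d(r) = r^\mathcal{I}(d)$, $\sigma_d(C) = C^\mathcal{I}\cap\mathsf{ars}^\mathcal{I}(d)$, $\sigma_d(\gamma) = \gamma^\mathcal{I}(d)\cap \mathsf{ars}^\mathcal{I}(d)$ (with $|\cdot|$ cardinality, other operations standard); $d \in \mathsf{succ}(\mathfrak{con})^\mathcal{I}$ iff $\sigma_d$ satisfies $\mathfrak{con}$. *)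

(* Defs.v *)
From HB Require Import structures.
From mathcomp Require Import all_boot all_order all_algebra finmap.
From mathcomp Require Import boolp classical_sets functions cardinality.

Set Implicit Arguments.
Unset Strict Implicit.
Unset Printing Implicit Defensive.

Local Open Scope classical_set_scope.

(* Four separate types, so the sets of names are pairwise disjoint. *)
Record vocabulary := Vocabulary {
  NC : countType;
  NR : countType;
  NI : countType;
  NF : countType
}.

Record concrete_domain := ConcreteDomain {
  predicate : countType;
  arity : predicate -> nat;
  carrier : Type;
  holds : forall P : predicate, set ((arity P).-tuple carrier);
  predicate_inhabited : inhabited predicate
}.

Inductive feature_path (V : vocabulary) :=
| FPath of NF V
| RFPath of NR V & NF V.

(* [Next f] is the pointer written "∂f". *)
Inductive feature_pointer (V : vocabulary) :=
| Here of NF V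
| Next of NF V.

Inductive feature_role (V : vocabulary) (D : concrete_domain) :=
| FRole (P : predicate D) of (arity P).-tuple (feature_pointer V).

(* [paexpr] builds n0 + n1 |s1| + ... + nk |sk| from left to right: [PAAdd l n s]
   is l + n |s|. *)
Inductive concept (V : vocabulary) (D : concrete_domain) : Type :=
| CName of NC V
| CNominal of NI V
| CNot of concept V D
| CAnd of concept V D & concept V D
| CEx (P : predicate D) of (arity P).-tuple (feature_path V)
| CSucc of constraint V D
with sterm (V : vocabulary) (D : concrete_domain) : Type :=
| SRole of NR V
| SConcept of concept V D
| SFRole of feature_role V D
| SEmpty
| SUniv
| SInter of sterm V D & sterm V D
| SUnion of sterm V D & sterm V D
| SCompl of sterm V D
with paexpr (V : vocabulary) (D : concrete_domain) : Type :=
| PAConst of nat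
| PAAdd of paexpr V D & nat & sterm V D
with constraint (V : vocabulary) (D : concrete_domain) : Type :=
| KSub of sterm V D & sterm V D
| KSetEq of sterm V D & sterm V D
| KNumEq of paexpr V D & paexpr V D
| KNumLt of paexpr V D & paexpr V D
| KDiv of nat & paexpr V D.

Arguments CName {V D}.
Arguments CNominal {V D}.
Arguments CEx {V D}.
Arguments SRole {V D}.
Arguments SEmpty {V D}.
Arguments SUniv {V D}.
Arguments PAConst {V D}.
Arguments FRole {V D}.

Fixpoint concept_frfree V D (C : concept V D) : bool :=
  match C with
  | CName _ | CNominal _ | CEx _ _ => true
  | CNot C1 => concept_frfree C1
  | CAnd C1 C2 => concept_frfree C1 && concept_frfree C2
  | CSucc k => constraint_frfree k
  end
with sterm_frfree V D (s : sterm V D) : bool :=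
  match s with
  | SRole _ | SEmpty | SUniv => true
  | SConcept C => concept_frfree C
  | SFRole _ => false
  | SInter s1 s2 | SUnion s1 s2 => sterm_frfree s1 && sterm_frfree s2
  | SCompl s1 => sterm_frfree s1
  end
with paexpr_frfree V D (l : paexpr V D) : bool :=
  match l with
  | PAConst _ => true
  | PAAdd l1 _ s => paexpr_frfree l1 && sterm_frfree s
  end
with constraint_frfree V D (k : constraint V D) : bool :=
  match k with
  | KSub s1 s2 | KSetEq s1 s2 => sterm_frfree s1 && sterm_frfree s2
  | KNumEq l1 l2 | KNumLt l1 l2 => paexpr_frfree l1 && paexpr_frfree l2
  | KDiv _ l => paexpr_frfree l
  end.

Record interpretation (V : vocabulary) (D : concrete_domain) := Interpretation {
  domain : Type;
  domain_inhabited : inhabited domain;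
  iconcept : NC V -> set domain;
  irole : NR V -> set (domain * domain);
  iindiv : NI V -> domain;
  ifeature : NF V -> domain -> option (carrier D)
}.

Section Semantics.
Context {V : vocabulary} {D : concrete_domain} (I : interpretation V D).
Notation Delta := (domain I).

Definition role_succ (r : NR V) (d : Delta) : set Delta :=
  [set e | irole (i := I) r (d, e)].

Definition ars (d : Delta) : set Delta := \bigcup_(r in setT) role_succ r d.

Definition finitely_branching : Prop := forall d, finite_set (ars d).

Definition path_values (p : feature_path V) (d : Delta) : set (carrier D) :=
  match p with
  | FPath f => [set c | ifeature (i := I) f d = Some c]
  | RFPath r f =>
      [set c | exists2 e, role_succ r d e & ifeature (i := I) f e = Some c]
  end.

Definition pointer_value (a : feature_pointer V) (d e : Delta) :
    option (carrier D) :=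
  match a with
  | Here f => ifeature (i := I) f d
  | Next f => ifeature (i := I) f e
  end.

Definition frole_ext (g : feature_role V D) : set (Delta * Delta) :=
  let: FRole P a := g in
  [set de | exists2 c : (arity P).-tuple (carrier D),
      (forall i, pointer_value (tnth a i) de.1 de.2 = Some (tnth c i)) &
      holds c].

(* The usual cardinality on finite sets, which are the only ones it is applied
   to in a finitely branching interpretation; the value on infinite sets is 0. *)
Definition set_card (A : set Delta) : nat :=
  #|` fset_set (A : set {classic Delta})|.

(* [sterm_ext s d], [paexpr_ext l d] and [constraint_sat k d] give the value of
   set terms, PA expressions and constraints under the assignment sigma_d. *)
Fixpoint concept_ext (C : concept V D) : set Delta :=
  match C with
  | CName A => iconcept (i := I) A
  | CNominal a => [set iindiv I a]
  | CNot C1 => ~` concept_ext C1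
  | CAnd C1 C2 => concept_ext C1 `&` concept_ext C2
  | CEx P p =>
      [set d | exists2 c : (arity P).-tuple (carrier D),
          (forall i, path_values (tnth p i) d (tnth c i)) & holds c]
  | CSucc k => [set d | constraint_sat k d]
  end
with sterm_ext (s : sterm V D) (d : Delta) : set Delta :=
  match s with
  | SRole r => role_succ r d
  | SConcept C => concept_ext C `&` ars d
  | SFRole g => [set e | frole_ext g (d, e)] `&` ars d
  | SEmpty => set0
  | SUniv => ars d
  | SInter s1 s2 => sterm_ext s1 d `&` sterm_ext s2 d
  | SUnion s1 s2 => sterm_ext s1 d `|` sterm_ext s2 d
  | SCompl s1 => ars d `\` sterm_ext s1 d
  end
with paexpr_ext (l : paexpr V D) (d : Delta) : nat :=
  match l with
  | PAConst n => n
  | PAAdd l1 n s => (paexpr_ext l1 d + n * set_card (sterm_ext s d))%N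
  end
with constraint_sat (k : constraint V D) (d : Delta) : Prop :=
  match k with
  | KSub s1 s2 => sterm_ext s1 d `<=` sterm_ext s2 d
  | KSetEq s1 s2 => sterm_ext s1 d = sterm_ext s2 d
  | KNumEq l1 l2 => paexpr_ext l1 d = paexpr_ext l2 d
  | KNumLt l1 l2 => (paexpr_ext l1 d < paexpr_ext l2 d)%N
  | KDiv n l => (n %| paexpr_ext l d)%N
  end.

End Semantics.

Arguments concept_ext {V D} I C.

Definition equivalent V D (C1 C2 : concept V D) : Prop :=
  forall I : interpretation V D,
    finitely_branching I -> concept_ext I C1 = concept_ext I C2.

Inductive Qpred := QLt | QEq | QGt.

Definition Qpred_code (P : Qpred) : nat :=
  match P with QLt => 0 | QEq => 1 | QGt => 2 end.

Definition Qpred_decode (n : nat) : option Qpred :=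
  match n with 0 => Some QLt | 1 => Some QEq | 2 => Some QGt | _ => None end.

Lemma Qpred_codeK : pcancel Qpred_code Qpred_decode.
Proof. by case. Qed.

HB.instance Definition _ := Countable.copy Qpred (pcan_type Qpred_codeK).

Definition Qholds (P : Qpred) : set (2.-tuple rat) :=
  [set c | let x := tnth c ord0 in let y := tnth c ord_max in
    match P with
    | QLt => (x < y)%R
    | QEq => x = y
    | QGt => (x > y)%R
    end].

Definition Qdom : concrete_domain :=
  @ConcreteDomain Qpred (fun=> 2) rat Qholds (inhabits QLt).

Section Example.
Context {V : vocabulary} (child : NR V) (salary : NF V).

Definition salary_lt_next : feature_role V Qdom :=
  @FRole V Qdom QLt [tuple Here salary; Next salary].

Definition card_expr (s : sterm V Qdom) : paexpr V Qdom :=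
  PAAdd (PAConst 0) 1 s.

(* |s| > |t| is written |t| < |s|. *)
Definition C_ex : concept V Qdom :=
  CSucc (KNumLt
    (card_expr (SInter (SRole child) (SCompl (SFRole salary_lt_next))))
    (card_expr (SInter (SRole child) (SFRole salary_lt_next)))).

End Example.

(* Main.v *)
(** Without feature roles, a concept sees feature values only through concrete
    domain restrictions. Give a root of salary 0 three leaves as children, with
    salaries -1, 1, and either 1 or -1. The two choices yield the same set of
    salaries of children, hence the same concrete domain restrictions at the
    root, while a leaf has no successors and so only compares its salary with
    itself. No concept without feature roles tells the two interpretations
    apart, but [C_ex] holds at the root in only one of them. *)
Require Import Defs.
From mathcomp Require Import all_boot.
From mathcomp Require Import all_order all_algebra finmap.
From mathcomp Require Import boolp classical_sets cardinality.

Set Implicit Arguments.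
Unset Strict Implicit.
Unset Printing Implicit Defensive.

Local Open Scope classical_set_scope.

Scheme concept_mut := Induction for concept Sort Prop
with sterm_mut := Induction for sterm Sort Prop
with paexpr_mut := Induction for paexpr Sort Prop
with constraint_mut := Induction for constraint Sort Prop.

Section FeatureChange.
Context {V : vocabulary} {D : concrete_domain} (I : interpretation V D).

(** The domain stays definitionally the same, so extensions before and after the change can be
    compared by equality. *)
Definition with_features (g : NF V -> domain I -> option (carrier D)) :
    interpretation V D :=
  Interpretation (domain_inhabited I) (@iconcept _ _ I) (@irole _ _ I)
    (@iindiv _ _ I) g.

(** Once feature roles are excluded, features enter the semantics only through [CEx]; every other
    constructor follows by congruence in a mutual induction. *)
Lemma concept_ext_with_features (g : NF V -> domain I -> option (carrier D)) :
  (forall P (p : (arity P).-tuple (feature_path V)),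
     concept_ext (with_features g) (CEx P p) = concept_ext I (CEx P p)) ->
  forall C, concept_frfree C ->
    concept_ext (with_features g) C = concept_ext I C.
Proof.
move=> exE.
apply: (@concept_mut V D
  (fun C => concept_frfree C ->
     concept_ext (with_features g) C = concept_ext I C)
  (fun s => sterm_frfree s ->
     forall d : domain I, sterm_ext (I := with_features g) s d = sterm_ext s d)
  (fun l => paexpr_frfree l ->
     forall d : domain I, paexpr_ext (I := with_features g) l d = paexpr_ext l d)
  (fun k => constraint_frfree k ->
     forall d : domain I,
       constraint_sat (I := with_features g) k d = constraint_sat k d)) => //=.
- by move=> C IHC /IHC ->.
- by move=> C1 IH1 C2 IH2 /andP[/IH1 -> /IH2 ->].
- by move=> P p _; exact: exE.
- by move=> k IHk /IHk kE; apply/funext => d; exact: kE.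
- by move=> C IHC /IHC -> d.
- by move=> s1 IH1 s2 IH2 /andP[/IH1 s1E /IH2 s2E] d; rewrite s1E s2E.
- by move=> s1 IH1 s2 IH2 /andP[/IH1 s1E /IH2 s2E] d; rewrite s1E s2E.
- by move=> s IHs /IHs sE d; rewrite sE.
- by move=> l IHl n s IHs /andP[/IHl lE /IHs sE] d; rewrite lE sE.
- by move=> s1 IH1 s2 IH2 /andP[/IH1 s1E /IH2 s2E] d; rewrite s1E s2E.
- by move=> s1 IH1 s2 IH2 /andP[/IH1 s1E /IH2 s2E] d; rewrite s1E s2E.
- by move=> l1 IH1 l2 IH2 /andP[/IH1 l1E /IH2 l2E] d; rewrite l1E l2E.
- by move=> l1 IH1 l2 IH2 /andP[/IH1 l1E /IH2 l2E] d; rewrite l1E l2E.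
- by move=> n l IHl /IHl lE d; rewrite lE.
Qed.

Lemma set_card1 (x : domain I) : set_card [set x] = 1.
Proof. by rewrite /set_card (@fset_set1 {classic domain I}) cardfs1. Qed.

Lemma set_card2 (x y : domain I) : x <> y -> set_card [set x; y] = 2.
Proof.
move=> neq_xy; rewrite /set_card.
rewrite (@fset_setU {classic domain I}) ?(@fset_set1 {classic domain I}) //.
by rewrite cardfs2; case: (@eqP {classic domain I} x y).
Qed.

End FeatureChange.

Section Star.
Variable V : vocabulary.

(* [None] is the root; its child [Some None] has the salary of the child
   [Some (Some b)]. *)
Definition star_salary (b : bool) (d : option (option bool)) : rat :=
  if d is Some x then (if odflt b x then 1 else -1)%R else 0%R.

(** All role names are interpreted alike, and so are all features, so that [child] and [salary] can
    be arbitrary names. *)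
Definition star (b : bool) : interpretation V Qdom :=
  @Interpretation V Qdom (option (option bool)) (inhabits None) (fun=> set0)
    (fun=> [set de | de.1 = None /\ de.2 <> None]) (fun=> None)
    (fun=> Some \o star_salary b).

Lemma star_finitely_branching (b : bool) : finitely_branching (star b).
Proof. by move=> d; exact: (@finite_finset (option (option bool))). Qed.

Lemma star_root_path_values (b c : bool) (p : feature_path V) :
  path_values (I := star b) p None `<=` path_values (I := star c) p None.
Proof.
case: p => [f|r f] //= x [[y|] [_ //] _ [<-]].
(* A leaf [Some (Some x)] has a salary given by [x] alone, so this one has under [c] the salary that
   [Some y] has under [b]. *)
by exists (Some (Some (odflt b y))).
Qed.

Lemma star_leaf_path_values (b c : bool) (y : option bool)
    (p : feature_path V) (x : rat) :
  path_values (I := star b) p (Some y) x ->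
  x = star_salary b (Some y) /\
  path_values (I := star c) p (Some y) (star_salary c (Some y)).
Proof. by case: p => [f|r f] /=; [case=> <- | case=> z []]. Qed.

(** At the root the path values agree. At a leaf both paths yield its own salary, and whether [P]
    holds between a number and itself does not depend on the number. *)
Lemma star_restriction (b c : bool) (P : Qpred)
    (p : 2.-tuple (feature_path V)) :
  concept_ext (star b) (@CEx V Qdom P p) `<=`
  concept_ext (star c) (@CEx V Qdom P p).
Proof.
move=> [y|] /= [v pv Pv]; last first.
  by exists v => // i; exact: star_root_path_values (pv i).
exists [tuple star_salary c (Some y); star_salary c (Some y)] => [i|].
  rewrite (_ : tnth _ i = star_salary c (Some y)).
    exact: (star_leaf_path_values c (pv i)).2.
  by rewrite (tnth_nth 0%R); case: i => [[|[|]]].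
move: Pv; rewrite /Qholds /=.
rewrite (star_leaf_path_values c (pv ord0)).1.
rewrite (star_leaf_path_values c (pv ord_max)).1.
by case: P => //; rewrite Order.POrderTheory.ltxx.
Qed.

Lemma star_concept_ext (b c : bool) (C : concept V Qdom) :
  concept_frfree C -> concept_ext (star b) C = concept_ext (star c) C.
Proof.
(* [star b] is convertible to [star c] with its features replaced. *)
apply: (concept_ext_with_features (I := star c)) => P p.
by apply/seteqP; split; [exact: (@star_restriction b c)| exact: (@star_restriction c b)].
Qed.

(** The feature role selects the leaves of salary 1, and [b] is the majority value among the three
    leaves. *)
Lemma star_C_ex (child : NR V) (salary : NF V) (b : bool) :
  concept_ext (star b) (C_ex child salary) None <-> b.
Proof.
set s := SFRole (salary_lt_next salary).
have frE y : frole_ext (I := star b) (salary_lt_next salary) (None, Some y)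
    <-> odflt b y.
  split=> [[v ve]|by_].
    rewrite /= /Qholds /=.
    have [<-] := ve ord0; have [<-] := ve ord_max.
    by rewrite /=; case: (odflt b y).
  exists [tuple 0%R; 1%R] => // -[[|[|]]] //= lti.
  by rewrite by_.
have childE t : sterm_ext (I := star b) (SInter (SRole child) t) None =
    [set d | d <> None /\ sterm_ext (I := star b) t None d].
  by apply/seteqP; split=> d /= [] // [].
have arsE d : d <> None -> ars (I := star b) None d by exists child.
have posE : sterm_ext (I := star b) (SInter (SRole child) s) None =
    [set d | exists2 y, d = Some y & odflt b y = true].
  rewrite childE; apply/seteqP; split=> -[y|] /=.
  - by move=> [_ [/frE]]; exists y.
  - by case.
  - by move=> [_ [<-] /frE ?]; split=> //; split=> //; exact: arsE.
  - by case.
have negE : sterm_ext (I := star b) (SInter (SRole child) (SCompl s)) None =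
    [set d | exists2 y, d = Some y & odflt b y = false].
  rewrite childE; apply/seteqP; split=> -[y|] /=.
  - move=> [_ [ay nfr]]; exists y => //; apply/negbTE/negP => /frE fr.
    by apply: nfr.
  - by case.
  - move=> [_ [<-] /negbT/negP ny]; split=> //; split; first exact: arsE.
    by case=> /frE.
  - by case.
(* Counting by [b] and [~~ b] rather than by [true] and [false] treats both stars at once: two
   leaves against one. *)
have majE : [set d | exists2 y, d = Some y & odflt b y = b] =
    [set Some None; Some (Some b)].
  apply/seteqP; split=> d /=.
    by case=> -[y|] -> /=; [move=> ->; right | left].
  by case=> ->; eexists.
have minE : [set d | exists2 y, d = Some y & odflt b y = ~~ b] =
    [set Some (Some (~~ b))].
  apply/seteqP; split=> d /=; last by move=> ->; eexists.
  by case=> -[y|] -> /=; [move=> -> | case: (b)].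
have maj2 : set_card (I := star b) [set Some None; Some (Some b)] = 2.
  exact: set_card2.
have min1 : set_card (I := star b) [set Some (Some (~~ b))] = 1.
  exact: set_card1.
change ((0 + 1 * set_card (sterm_ext (I := star b) (SInter (SRole child) (SCompl s)) None) <
         0 + 1 * set_card (sterm_ext (I := star b) (SInter (SRole child) s) None))%N <-> b).
rewrite posE negE.
(* For [true] the comparison becomes 1 < 2, for [false] it becomes 2 < 1. *)
case: b {frE childE arsE posE negE} majE minE maj2 min1 => /= majE minE maj2 min1;
  by rewrite majE minE maj2 min1.
Qed.

End Star.

Theorem theorem1 (V : vocabulary) (child : NR V) (salary : NF V) :
  ~ exists C : concept V Qdom,
      concept_frfree C /\ equivalent C (C_ex child salary).
Proof.
move=> [C [frC eqC]].
suff : false by [].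
(* Here [false] is read as the parameter [b]: it remains to carry [C_ex] at the root from
   [star true] to [star false] by way of [C]. *)
apply/(star_C_ex child salary).
rewrite -(eqC _ (@star_finitely_branching V false)) (star_concept_ext _ true frC).
by rewrite (eqC _ (@star_finitely_branching V true)); apply/star_C_ex.
Qed.
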